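(* Let $f(n)$ be the number of genus one labeled circle trees on $n$ points (counted up to isomorphism of labeled circle trees). If $n>3$ is odd, then $f(n)$ is divisible by $n$. If $n>3$ is even, then $f(n)$ is divisible by $\frac n2$.
   Context: A labeled circle tree (l-c-tree) on $n$ points is a tree whose $n$ vertices are placed on a circle and labeled $1,\dots,n$ in counterclockwise order, with edges drawn as straight line segments inside the circle. Two l-c-trees are isomorphic if they have the same edges in terms of labels; so l-c-trees on $n$ points up to isomorphism are exactly the trees on the vertex set $\{1,\dots,n\}$. Genus. Let $T$ be an l-c-tree with $m\geq 1$ edges. Split each vertex $v$ of degree $d$ into $d$ nearby points on the circle, each being the endpoint of one of the $d$ edges at $v$, in such a way that edges sharing an endpoint $v$ do not cross (going counterclockwise through the $d$ points, the other endpoints of the edges are met in clockwise order starting from $v$). This gives $N=2m$ points on the circle, numbered $1,\dots,N$ counterclockwise, and a fixed-point-free involution $\alpha$ of $\{1,\dots,N\}$ exchanging the two endpoints of each edge (the matching of $T$). With $\sigma=(1\,2\,\cdots\,N)$ and $z(\pi)$ the number of cycles of a permutation $\pi$ (fixed points included), the genus of $T$ is $g=1+\frac12\left(N-1-z(\alpha)-z(\alpha^{-1}\sigma)\right)$ (product from right to left). *)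

(* Defs.v *)
From mathcomp Require Import all_boot all_order all_algebra all_fingroup.

Set Implicit Arguments.
Unset Strict Implicit.
Unset Printing Implicit Defensive.

(* The vertices of a labeled circle tree are the elements of 'I_n, placed on
   the circle counterclockwise as 0, 1, ..., n-1 (labels shifted by one).  As
   isomorphic l-c-trees are those with the same edges in terms of labels,
   l-c-trees up to isomorphism are just edge sets E : {set {set 'I_n}}. *)
Section CircleTree.
Variables (n : nat) (E : {set {set 'I_n}}).

Definition adj : rel 'I_n := fun v w => [set v; w] \in E.

Definition simple_graph : bool := [forall e in E, #|e| == 2].

Definition connected : bool := [forall v, forall w, connect adj v w].

(* A duplicate-free sequence of vertices has size at most n, so bounding the
   length k by n excludes no cycle. *)
Definition acyclic : bool :=
  [forall k : 'I_n.+1, forall c : k.-tuple 'I_n,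
     (2 < k) ==> ~~ (path.cycle adj c && uniq c)].

Definition is_tree : bool := [&& simple_graph, connected & acyclic].

(* v - 1, v - 2, ..., v + 1 modulo n: the vertices other than v, in clockwise
   order starting from v. *)
Definition clockwise_from (v : 'I_n) : seq 'I_n :=
  rev (behead (rot v (enum 'I_n))).

(* The points obtained by splitting the vertices, in counterclockwise order:
   (v, w) is the endpoint near v of the edge joining v and w. *)
Definition points : seq ('I_n * 'I_n) :=
  [seq (v, w) | v <- enum 'I_n, w <- filter (adj v) (clockwise_from v)].

Definition npoints : nat := size points.

Definition point (i : 'I_npoints) : 'I_n * 'I_n := tnth (in_tuple points) i.

Lemma mem_clockwise_from (v w : 'I_n) : (w \in clockwise_from v) = (w != v).
Proof.
have szv : v < size (enum 'I_n) by rewrite size_enum_ord.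
have ur : uniq (rot v (enum 'I_n)) by rewrite rot_uniq enum_uniq.
have mr : w \in rot v (enum 'I_n) by rewrite mem_rot mem_enum.
rewrite /clockwise_from mem_rev; move: ur mr.
rewrite /rot (drop_nth v szv) nth_ord_enum /= inE => /andP[vN _].
by case: eqVneq => [->|_] //= _; apply/negbTE.
Qed.

Lemma mem_points (v w : 'I_n) : ((v, w) \in points) = (w != v) && adj v w.
Proof.
apply/allpairsPdep/idP => [[x [y [_]]]|vw].
  by rewrite mem_filter mem_clockwise_from => /andP[? ?] [-> ->]; apply/andP.
exists v, w; split=> //; first by rewrite mem_enum.
by rewrite mem_filter mem_clockwise_from andbC.
Qed.

Lemma swap_points (p : 'I_n * 'I_n) : p \in points -> swap_pair p \in points.
Proof.
by case: p => v w; rewrite !mem_points /adj /= eq_sym setUC.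
Qed.

Lemma points_uniq : uniq points.
Proof.
apply: allpairs_uniq_dep; first exact: enum_uniq.
- move=> v _; rewrite filter_uniq // /clockwise_from rev_uniq.
  have : uniq (rot v (enum 'I_n)) by rewrite rot_uniq enum_uniq.
  by case: (rot _ _) => //= ? ? /andP[].
- by case=> [a b] [c d] _ _ /= [-> ->].
Qed.

Lemma mate_proof (i : 'I_npoints) :
  index (swap_pair (point i)) points < npoints.
Proof. by rewrite index_mem swap_points // /point mem_tnth. Qed.

Definition mate (i : 'I_npoints) : 'I_npoints := Ordinal (mate_proof i).

Lemma point_mate (i : 'I_npoints) : point (mate i) = swap_pair (point i).
Proof.
rewrite /point (tnth_nth (point i)) /= nth_index //.
by rewrite swap_points // mem_tnth.
Qed.

Lemma mateK : involutive mate.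
Proof.
move=> i; apply: val_inj.
rewrite [LHS]/= point_mate swap_pairK /point (tnth_nth (point i)).
exact: index_uniq (ltn_ord i) points_uniq.
Qed.

Definition matching : {perm 'I_npoints} := perm (inv_inj mateK).

Definition rotation : {perm 'I_npoints} := perm (@ordS_inj npoints).

Definition ncycles (N : nat) (s : {perm 'I_N}) : nat := #|porbits s|.

(* MathComp composes permutations from left to right: (s * t) x = t (s x), so
   the product "alpha^-1 sigma" taken from right to left is sigma * alpha^-1. *)
Definition genus : rat :=
  (1 + (npoints%:R - 1 - (ncycles matching)%:R
        - (ncycles (rotation * matching^-1)%g)%:R) / 2%:R)%R.

End CircleTree.

Definition num_genus1_trees (n : nat) : nat :=
  #|[set E : {set {set 'I_n}} | is_tree E && (genus E == 1%R)]|.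

(* Main.v *)
(* Turning the circle by one step acts on the genus one trees, so it suffices
   to bound the stabilizer of a tree in the cyclic group of order n generated
   by the turn.  A nontrivial turn fixes no vertex, and an automorphism of a
   tree without fixed vertex flips an edge; the square of the turn then fixes a
   vertex, hence is trivial.  So every stabilizer has order 1 or 2, and every
   orbit has n or n/2 elements. *)

Require Import Defs.
From mathcomp Require Import all_boot.
From mathcomp Require Import all_fingroup cyclic zify.

Set Implicit Arguments.
Unset Strict Implicit.
Unset Printing Implicit Defensive.

(** * Prefixes of paths, and orbits of conjugate permutations *)

Lemma last_take (T : Type) (x : T) (p : seq T) (k : nat) :
  k <= size p -> last x (take k p) = nth x (x :: p) k.
Proof.
move=> kp; rewrite (last_nth x) size_takel //.
by case: k kp => // k kp /=; rewrite nth_take.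
Qed.

(** [phi] conjugates [s] to [s'], so taking images under [phi] is a bijection between their orbits.
    The two types may differ because a tree and its turned copy number their points in different
    ordinal types. *)
Lemma card_porbits_conj (T T' : finType) (s : {perm T}) (s' : {perm T'})
    (phi : T -> T') :
  bijective phi -> (forall x, phi (s x) = s' (phi x)) ->
  #|porbits s'| = #|porbits s|.
Proof.
move=> bij_phi phiM.
have phiX k x : phi ((s ^+ k)%g x) = (s' ^+ k)%g (phi x).
  by rewrite !permX; elim: k => //= k <-.
have phiO x : phi @: porbit s x = porbit s' (phi x).
  apply/setP=> y; apply/imsetP/porbitP => [[z /porbitP[k ->] ->]|[k ->]].
    by exists k.
  by exists ((s ^+ k)%g x); rewrite ?mem_porbit.
rewrite -(card_imset (mem (porbits s)) (imset_inj (bij_inj bij_phi))).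
case: bij_phi => psi phiK psiK.
apply: eq_card => O; apply/imsetP/imsetP => [[y _ ->]|[_ /imsetP[x _ ->] ->]].
  by exists (porbit s (psi y)); rewrite ?imset_f // phiO psiK.
by exists (phi x).
Qed.

(** * Automorphisms of a tree without fixed vertex *)

Section Tree.
Variables (n : nat) (E : {set {set 'I_n}}).
Hypothesis treeE : is_tree E.

Lemma adj_irr (v : 'I_n) : ~~ adj E v v.
Proof.
case/and3P: treeE => /forall_inP simpleE _ _; apply/negP => /simpleE.
by rewrite setUid cards1.
Qed.

(** There are only finitely many vertices, so the walk returns somewhere; without backtracking, a
    shortest return closes a cycle of length at least 3. *)
Lemma infinite_walk_backtracks (w : nat -> 'I_n) :
  (forall i, adj E (w i) (w i.+1)) -> ~ (forall i, w i != w i.+2).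
Proof.
move=> w_adj w_nb.
suff neq d i : 0 < d -> w i <> w (i + d).
  suff /leq_card : injective (fun i : 'I_n.+1 => w i).
    by rewrite !card_ord ltnn.
  move=> i j eq_w; apply: val_inj => /=; case: (ltngtP i j) => // lt_ij.
    by case: (neq (j - i) i); rewrite ?subn_gt0 // subnKC // ltnW.
  by case: (neq (i - j) j); rewrite ?subn_gt0 // subnKC // ltnW.
elim/ltn_ind: d i => d IH i d_gt0 eq_w.
have d_gt2 : 2 < d.
  case: d d_gt0 eq_w {IH} => [|[|[|d]]] // _ eq_w.
    by have := w_adj i; rewrite -addn1 -eq_w (negbTE (adj_irr _)).
  by have := w_nb i; rewrite -addn2 -eq_w eqxx.
pose c := [seq w j | j <- iota i d].
have uc : uniq c.
  rewrite map_inj_in_uniq ?iota_uniq // => j k; rewrite !mem_iota => hj hk eq_jk.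
  case: (ltngtP j k) => // lt_jk.
    by case: (IH (k - j) _ j); rewrite ?subnKC //; lia.
  by case: (IH (j - k) _ k); rewrite ?subnKC //; lia.
have cc : path.cycle (adj E) c.
  have w_path k m : path (adj E) (w k) [seq w j | j <- iota k.+1 m].
    by elim: m k => //= m IHm k; rewrite w_adj IHm.
  rewrite /c; case: d d_gt0 eq_w {IH d_gt2 uc c} => // d _ eq_w /=.
  (* Reading the closing vertex [w i] as [w (i + d)] turns the whole cycle into a stretch of the
     walk. *)
  rewrite {2}eq_w -map_rcons.
  suff -> : rcons (iota i.+1 d) (i + d.+1) = iota i.+1 d.+1 by exact: w_path.
  by rewrite -(addn1 d) iotaD -cats1 addn1 addSnnS.
have sz_c : size c = d by rewrite size_map size_iota.
have d_le : d < n.+1.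
  by rewrite ltnS -sz_c -[n in _ <= n]card_ord -(card_uniqP uc) max_card.
case/and3P: treeE => _ _ /forallP /(_ (Ordinal d_le)) /=.
have sz_ct : size c == d by apply/eqP.
by move=> /forallP /(_ (Tuple sz_ct)); rewrite d_gt2 /= cc uc.
Qed.

(* Among all paths from a vertex v to s v take a shortest one.  Unless s flips
   an edge, its translates by the powers of s concatenate to an infinite walk
   without backtracking. *)
Lemma fixfree_automorphism_flip (s : {perm 'I_n}) :
  0 < n -> (forall v w, adj E v w -> adj E (s v) (s w)) ->
  (forall v, s v != v) -> exists v, s (s v) = v.
Proof.
move=> n_gt0 s_adj s_free.
suff /existsP[v /eqP] : [exists v, s (s v) == v] by exists v.
apply/contraT; rewrite negb_exists => /forallP s2_free; exfalso.
suff no_path d v p :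
    size p = d -> path (adj E) v p -> last v p <> s v.
  case/and3P: treeE => _ /forallP /(_ (Ordinal n_gt0)).
  move=> /forallP /(_ (s (Ordinal n_gt0))) /connectP[p p_path p_last] _.
  exact: no_path p_path (esym p_last).
elim/ltn_ind: d v p => d IH v p sz_p p_path p_last.
pose q := nth v (v :: p).
have last_q k : k <= d -> last v (take k p) = q k.
  by rewrite -sz_p; apply: last_take.
have q_d : q d = s v by rewrite -p_last (last_nth v) sz_p.
have d_gt0 : 0 < d.
  by case: d q_d {IH sz_p last_q} => // /esym/eqP; rewrite (negbTE (s_free v)).
(* The walk runs through the path, then its image under [s], then its image under [s] twice, and so
   on. *)
pose w i := iter (i %/ d) s (q (i %% d)).
(* The case [r = d] is the gluing: a translate ends where the next one begins, as [q d = s v]. *)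
have wE a r : r <= d -> w (a * d + r) = iter a s (q r).
  rewrite /w leq_eqVlt => /predU1P[->|lt_rd].
    by rewrite addnC -mulSn mulnK // modnMl q_d -iterSr.
  by rewrite divnMDl // divn_small // addn0 modnMDl modn_small.
have iter_adj a x y : adj E x y -> adj E (iter a s x) (iter a s y).
  by move=> xy; elim: a => //= a; apply: s_adj.
have iter_inj a : injective (iter a s).
  by elim: a => //= a IHa x y /perm_inj /IHa.
have q_adj r : r < d -> adj E (q r) (q r.+1).
  by rewrite -sz_p; apply: (pathP v p_path).
apply: (@infinite_walk_backtracks w) => i.
  rewrite {1 2}(divn_eq i d) -addnS !wE ?iter_adj ?q_adj ?ltn_pmod //.
  exact/ltnW/ltn_pmod.
have := ltn_pmod i d_gt0; move: (divn_eq i d).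
move: (i %/ d) (i %% d) => a r -> lt_rd.
(* A backtrack inside one translate: cutting out its two edges leaves a shorter path from [v] to
   [s v]. *)
have [lt2|le2] := ltnP r.+1 d.
  rewrite -!addnS !wE ?(inj_eq (@iter_inj a)) //; last exact: ltnW.
  apply/eqP=> eq_q.
  apply: (IH (d - 2) _ v (take r p ++ drop r.+2 p)); first by lia.
  - by rewrite size_cat size_takel ?size_drop; lia.
  - have := p_path; rewrite -{1}(cat_take_drop r.+2 p) !cat_path.
    rewrite !last_q ?eq_q; [|lia..] => /andP[_ ->].
    by rewrite andbT take_path.
  - rewrite last_cat last_q ?eq_q -?last_q; [|lia..].
    by rewrite -last_cat cat_take_drop.
(* A backtrack where two translates meet says [q (d - 1) = s (q 1)]. For [d = 1] this is
   [v = s (s v)]; otherwise dropping the first and last edge leaves a shorter path from [q 1] to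
   [s (q 1)], which is why the induction covers all starting vertices. *)
have def_d : d = r.+1 by lia.
have -> : (a * d + r).+2 = a.+1 * d + 1 by rewrite mulSn def_d; lia.
rewrite !wE ?iterSr ?(inj_eq (@iter_inj a)) //; last by lia.
apply/eqP=> eq_q.
case: r => [|r] in lt_rd le2 def_d eq_q *.
  move: eq_q (s2_free v); rewrite -def_d in q_d *.
  move: q_d; rewrite def_d => ->.
  by rewrite {1}/q /= => <-; rewrite eqxx.
rewrite {}/q /= in eq_q {last_q q_d w wE q_adj}.
case: p sz_p p_path p_last eq_q => [|b p] /=; first by lia.
move=> sz_p /andP[_ p_path] p_last eq_q.
apply: (IH r _ b (take r p)); first by lia.
- by rewrite size_takel //; lia.
- exact: take_path.
- rewrite -eq_q last_take; last by lia.
  by apply: set_nth_default; rewrite /=; lia.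
Qed.

End Tree.

(** * Relabeling preserves trees *)

(** Phrased as the action on vertices lifted twice to sets, so that orbits and stabilizers of trees
    are available. *)
Definition relabel (n : nat) (E : {set {set 'I_n}}) (g : {perm 'I_n}) :
  {set {set 'I_n}} := ('P^*^*)%act E g.

Lemma adj_relabel n (E : {set {set 'I_n}}) (g : {perm 'I_n}) (v w : 'I_n) :
  adj (relabel E g) (g v) (g w) = adj E v w.
Proof.
rewrite /adj /relabel /= /setact.
rewrite (_ : [set g v; g w] = ('P^* [set v; w] g)%act).
  by rewrite (mem_imset _ _ (act_inj _ g)).
by rewrite /= /setact imsetU1 imset_set1.
Qed.

Lemma connected_relabel n (E : {set {set 'I_n}}) (g : {perm 'I_n}) :
  connected E -> connected (relabel E g).
Proof.
move=> /forallP conE; apply/forallP => v; apply/forallP => w.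
have /forallP /(_ ((g^-1)%g w)) /connectP[p p_path p_last] := conE ((g^-1)%g v).
apply/connectP; exists (map g p); last first.
  by rewrite -{1}(permKV g v) last_map -p_last permKV.
rewrite -{1}(permKV g v) path_map.
by apply: sub_path p_path => x y /=; rewrite adj_relabel.
Qed.

Lemma acyclic_relabel n (E : {set {set 'I_n}}) (g : {perm 'I_n}) :
  acyclic E -> acyclic (relabel E g).
Proof.
move=> /forallP acE; apply/forallP => k; apply/forallP => c.
have /forallP /(_ (map_tuple (g^-1)%g c)) := acE k.
apply: contraLR; rewrite !negb_imply !andbT => /and3P[-> cc uc] /=.
rewrite (map_inj_uniq perm_inj) uc andbT cycle_map.
apply: sub_cycle cc => x y /=.
by rewrite -{1}(permKV g x) -{1}(permKV g y) adj_relabel.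
Qed.

Lemma is_tree_relabel n (E : {set {set 'I_n}}) (g : {perm 'I_n}) :
  is_tree E -> is_tree (relabel E g).
Proof.
case/and3P=> /forall_inP simpleE conE acE; apply/and3P; split.
- apply/forall_inP => _ /imsetP[e /simpleE e2 ->].
  by rewrite card_setact.
- exact: connected_relabel.
- exact: acyclic_relabel.
Qed.

(** * Effect of the turn on the list of split points *)

Definition turn (n : nat) : {perm 'I_n} := perm (@ordS_inj n).

Lemma map_ordS_enum n : map (@ordS n) (enum 'I_n) = rot 1 (enum 'I_n).
Proof.
apply: (inj_map val_inj); rewrite map_rot val_enum_ord -map_comp.
rewrite (eq_map (g := (fun i => i.+1 %% n) \o val)) // map_comp val_enum_ord.
case: n => // n; rewrite {2}/iota -/iota rot1_cons.
rewrite -{2}addn1 iotaD cats1 map_rcons modnn (iotaDl 1 0).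
congr rcons; apply/eq_in_map => i; rewrite mem_iota => /andP[_ lt_in].
by rewrite modn_small.
Qed.

Lemma clockwise_from_turn n (v : 'I_n) :
  clockwise_from (turn n v) = map (turn n) (clockwise_from v).
Proof.
have turnE s : map (turn n) s = map (@ordS n) s.
  by apply: eq_map => x; rewrite permE.
rewrite /clockwise_from map_rev -behead_map turnE map_rot map_ordS_enum permE.
congr (rev (behead _)); rewrite rot_rot -rotS; last by rewrite size_enum_ord.
have [lt|ge] := ltnP v.+1 n; first by rewrite /= modn_small.
have Dn : v.+1 = n by apply/eqP; rewrite eqn_leq ltn_ord.
by rewrite /= Dn modnn rot0 rot_oversize // size_enum_ord.
Qed.

Definition turn2 (n : nat) (p : 'I_n * 'I_n) : 'I_n * 'I_n :=
  (turn n p.1, turn n p.2).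

Lemma turn2_inj n : injective (@turn2 n).
Proof. by move=> [a b] [c d] [/perm_inj -> /perm_inj ->]. Qed.

Lemma flatten_rot1 (T : Type) (ss : seq (seq T)) :
  exists k, flatten (rot 1 ss) = rot k (flatten ss).
Proof.
case: ss => [|s ss]; first by exists 0.
by exists (size s); rewrite rot1_cons flatten_rcons /= rot_size_cat.
Qed.

(** The turn carries the block of points at [v] to the block at its successor and keeps the
    clockwise order inside it. Hence only the place where the numbering starts changes. *)
Lemma points_relabel_turn n (E : {set {set 'I_n}}) :
  exists k, map (@turn2 n) (points E) = rot k (points (relabel E (turn n))).
Proof.
pose block v := [seq (v, w) | w <- clockwise_from v & adj (relabel E (turn n)) v w].
have [k rotk] := flatten_rot1 (map block (enum 'I_n)).
exists k; rewrite -[RHS]rotk -map_rot -map_ordS_enum /points map_flatten -!map_comp.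
congr flatten; apply: eq_map => v /=.
rewrite /block -[ordS v](permE (@ordS_inj n)) clockwise_from_turn.
rewrite filter_map -!map_comp; congr map.
by apply: eq_filter => w /=; rewrite adj_relabel.
Qed.

Lemma point_inj n (E : {set {set 'I_n}}) : injective (@point n E).
Proof.
move=> i j eq_ij; apply/val_inj/eqP.
rewrite -(nth_uniq (point i) (ltn_ord i) (ltn_ord j) (points_uniq E)).
by rewrite -!(tnth_nth _ (in_tuple (points E))) -!/(point _) eq_ij.
Qed.

(** Expresses the rotation by the cyclic successor [next], which does not depend on where the list
    starts. *)
Lemma point_ordS n (E : {set {set 'I_n}}) (i : 'I_(npoints E)) :
  point (ordS i) = next (points E) (point i).
Proof.
rewrite next_nth /point mem_tnth !(tnth_nth (point i)) /=.
rewrite index_uniq ?points_uniq //.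
move: (point i) (nat_of_ord i) (ltn_ord i) => p0 k; rewrite /npoints.
case: (points E) => // x s lt_ks /=.
have [lt|ge] := ltnP k.+1 (size s).+1.
  by rewrite modn_small //=; apply: set_nth_default.
have -> : k = size s by apply/eqP; rewrite -eqSS eqn_leq ge andbT.
(* At the last index, [next] reads past the tail and returns its default, the head of the list,
   matching the wrap-around of [ordS]. *)
by rewrite modnn (nth_default x).
Qed.

(** * Invariance of the genus under the turn *)

Section Turn.
Variables (n : nat) (E : {set {set 'I_n}}).
Let E' := relabel E (turn n).

Lemma turn2_points p : (turn2 p \in points E') = (p \in points E).
Proof.
have [k ptsE] := points_relabel_turn E.
by rewrite -(mem_rot k) -ptsE (mem_map (@turn2_inj n)).
Qed.

Lemma npoints_turn : npoints E' = npoints E.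
Proof.
have [k ptsE] := points_relabel_turn E.
by rewrite /npoints -(size_rot k) -ptsE size_map.
Qed.

Lemma turn_point_proof (i : 'I_(npoints E)) :
  index (turn2 (point i)) (points E') < npoints E'.
Proof. by rewrite index_mem turn2_points mem_tnth. Qed.

Definition turn_point (i : 'I_(npoints E)) : 'I_(npoints E') :=
  Ordinal (turn_point_proof i).

Lemma point_turn (i : 'I_(npoints E)) : point (turn_point i) = turn2 (point i).
Proof.
rewrite {1}/point (tnth_nth (turn2 (point i))) /= nth_index //.
by rewrite turn2_points mem_tnth.
Qed.

Lemma turn_point_bij : bijective turn_point.
Proof.
apply: inj_card_bij; last by rewrite !card_ord npoints_turn.
by move=> i j /(congr1 (@point n E')); rewrite !point_turn => /turn2_inj/point_inj.
Qed.

Lemma turn_point_matching (i : 'I_(npoints E)) :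
  turn_point (matching E i) = matching E' (turn_point i).
Proof.
by apply: point_inj; rewrite point_turn !permE !point_mate point_turn.
Qed.

Lemma turn_point_rotation (i : 'I_(npoints E)) :
  turn_point (rotation E i) = rotation E' (turn_point i).
Proof.
apply: point_inj; rewrite point_turn !permE !point_ordS point_turn.
have [k ptsE] := points_relabel_turn E.
rewrite -(next_rot k (points_uniq E')) -ptsE next_map //; first exact: turn2_inj.
exact: points_uniq.
Qed.

Lemma genus_turn : genus E' = genus E.
Proof.
rewrite /genus /ncycles (card_porbits_conj turn_point_bij turn_point_matching).
rewrite (card_porbits_conj (s := (rotation E * (matching E)^-1)%g) turn_point_bij).
  by rewrite npoints_turn.
(* Applying the matching of the turned tree to both sides removes the inverses. *)
move=> i; rewrite !permM; apply: (@perm_inj _ (matching E')).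
by rewrite -turn_point_matching !permKV turn_point_rotation.
Qed.

End Turn.

(** * Powers of the turn, stabilizers and orbit sizes *)

Lemma turnX n (k : nat) (v : 'I_n) : (turn n ^+ k)%g v = (v + k) %% n :> nat.
Proof.
rewrite permX; elim: k => [|k IHk] /=; first by rewrite addn0 modn_small.
by rewrite permE /= IHk -addn1 modnDml addn1 addnS.
Qed.

(** Powers of the turn are translations modulo [n], so one fixed vertex forces [k] to be 0 modulo
    [n]. *)
Lemma turnX_eq1 n (k : nat) (v : 'I_n) :
  (turn n ^+ k)%g v = v -> (turn n ^+ k)%g = 1%g.
Proof.
move=> /(congr1 (@nat_of_ord n)); rewrite turnX => eq_v.
have dvd_k : k = 0 %[mod n].
  by apply/eqP; rewrite -(eqn_modDl v) addn0 eq_v modn_small.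
apply/permP => w; rewrite perm1; apply: val_inj.
by rewrite /= turnX -modnDmr dvd_k mod0n addn0 modn_small.
Qed.

Lemma order_turn n : 0 < n -> #[turn n]%g = n.
Proof.
move=> n_gt0; apply/eqP; rewrite eqn_dvd order_dvdn.
have eq1 k : (turn n ^+ k == 1)%g = (n %| k).
  apply/eqP/idP => [/permP /(_ (Ordinal n_gt0)) /(congr1 (@nat_of_ord n))|/eqP nk].
    by rewrite turnX perm1 /= add0n => /eqP.
  apply: (@turnX_eq1 _ _ (Ordinal n_gt0)); apply: val_inj.
  by rewrite /= turnX add0n.
by rewrite eq1 dvdnn -eq1 expg_order eqxx.
Qed.

(** The stabilizer lies in a cyclic group, so it has a single generator [g], and it is enough that
    the square of [g] is trivial. *)
Lemma card_stab_turn n (E : {set {set 'I_n}}) :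
  0 < n -> is_tree E -> #|'C_<[turn n]>[E | 'P^*^*]|%g %| 2.
Proof.
move=> n_gt0 treeE; set C := 'C_<[_]>[_ | _]%g.
have /cyclicP[g Cg] : cyclic C by apply: cyclicS (cycle_cyclic (turn n)); apply: subsetIl.
have /setIP[/cycleP[k Dg] /astab1P fixE] : g \in C by rewrite Cg cycle_id.
rewrite Cg -orderE order_dvdn.
have [/existsP[v /eqP fix_v]|] := boolP [exists v, g v == v].
  by rewrite Dg (turnX_eq1 (v := v)) ?expg1n // -Dg.
rewrite negb_exists => /forallP g_free.
have g_adj v w : adj E v w -> adj E (g v) (g w).
  by rewrite -(adj_relabel E g) /relabel fixE.
have [v flip] := fixfree_automorphism_flip treeE n_gt0 g_adj g_free.
by rewrite Dg -expgM (turnX_eq1 (v := v)) // expgM -Dg permX.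
Qed.

Theorem theorem4 (n : nat) (hn : 3 < n) :
  (odd n -> n %| num_genus1_trees n) /\
  (~~ odd n -> n %/ 2 %| num_genus1_trees n).
Proof.
have n_gt0 : 0 < n by apply: leq_trans hn.
rewrite /num_genus1_trees; set S := [set E | _].
have actS : [acts <[turn n]>, on S | 'P^*^*]%g.
  rewrite cycle_subG !inE; apply/subsetP => E; rewrite !inE => /andP[treeE gE].
  rewrite -/(relabel E (turn n)) genus_turn gE andbT.
  exact: is_tree_relabel.
(* The count is the sum of the orbit sizes, so it suffices to treat each orbit. *)
rewrite -(acts_sum_card_orbit actS).
have orbit_card O : O \in orbit 'P^*^*%act <[turn n]>%g @: S ->
    exists2 d, d %| 2 & #|O| * d = n.
  case/imsetP => E; rewrite inE => /andP[treeE _] ->.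
  exists #|'C_<[turn n]>[E | 'P^*^*]|%g; first exact: card_stab_turn.
  by rewrite card_orbit_stab -orderE order_turn.
split=> parity_n; apply: dvdn_sum => O /orbit_card[d d2 On].
  have /eqP d1 : d == 1.
    (* For odd [n] the stabilizer order [d] divides both 2 and [n]. *)
    rewrite -dvdn1; have /eqP <- : coprime 2 n by rewrite coprime2n.
    by rewrite dvdn_gcd d2 -On dvdn_mull.
  by move: On; rewrite d1 muln1 => ->.
(* With [2 = q * d], the orbit has [q] times [n / 2] elements; this is checked after doubling both
   sides. *)
case/dvdnP: d2 => q q2; apply/dvdnP; exists q.
apply/eqP; rewrite -(eqn_pmul2r (isT : 0 < 2)) -mulnA divnK ?dvdn2 //.
by rewrite {1}q2 mulnCA On.
Qed.
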